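(* For $\alpha>-1$ let $(P_n(\alpha;x))_{n\ge0}$ denote the orthonormal symmetric Jacobi polynomials. (i) For $\alpha\ge 1/2$ we have $$\inf\{P_n^2(\alpha;x)+P_{n-1}^2(\alpha;x)\mid x\in\mathbb R,\ n\in\mathbb N\}\ge\frac{2}{2\alpha+3}.$$ (ii) For $-1<\alpha<1/2$ we have $$\inf\{P_n^2(\alpha;x)+P_{n-1}^2(\alpha;x)\mid x\in\mathbb R,\ n\in\mathbb N\}=0.$$
   Context: $P_n(\alpha;x)$, $n\ge0$, are the polynomials of degree $n$ with positive leading coefficient that are orthonormal with respect to the probability measure $c_\alpha(1-x^2)^\alpha\,dx$ on $]-1,1[$, where $1/c_\alpha=B(\alpha+1,1/2)$ (Beta function). Equivalently, $P_n(\alpha;x)$ is the positive multiple of the Jacobi polynomial $P_n^{(\alpha,\alpha)}(x)$ of norm $1$ in $L^2(c_\alpha(1-x^2)^\alpha dx)$. Here $\mathbb N=\{1,2,\dots\}$. *)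

(* Defs.v *)
From HB Require Import structures.
From mathcomp Require Import all_boot all_order all_algebra.
From mathcomp Require Import all_classical all_reals all_analysis.

Set Implicit Arguments.
Unset Strict Implicit.
Unset Printing Implicit Defensive.

Import Order.TTheory GRing.Theory Num.Theory.
Import numFieldNormedType.Exports.

Local Open Scope classical_set_scope.
Local Open Scope ring_scope.

(* Euler's Beta function at real arguments; the library's [beta_fun] takes
   natural numbers only.  The integral is finite when 0 < a and 0 < b. *)
Definition real_beta (R : realType) (a b : R) : R :=
  \int[@lebesgue_measure R]_(t in `]0, 1[) (t `^ (a - 1) * (1 - t) `^ (b - 1)).

Definition jacobi_const (R : realType) (alpha : R) : R :=
  (real_beta (alpha + 1) 2^-1)^-1.

Definition jacobi_density (R : realType) (alpha x : R) : R :=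
  jacobi_const alpha * (1 - x ^+ 2) `^ alpha.

(* The integral is extended-real valued: the library gives a measurable function
   that is not integrable an infinite integral, so an equation with a finite
   right-hand side includes integrability. *)
Definition jacobi_inner (R : realType) (alpha : R) (p q : {poly R}) : \bar R :=
  (\int[@lebesgue_measure R]_(x in `](-1)%R, 1%R[)
     (p.[x] * q.[x] * jacobi_density alpha x)%:E)%E.

(* [size p = n.+1] says that p has degree exactly n.  These conditions determine
   the sequence P uniquely. *)
Definition is_orthonormal_jacobi (R : realType) (alpha : R)
    (P : nat -> {poly R}) : Prop :=
  [/\ forall n, size (P n) = n.+1,
      forall n, 0 < lead_coef (P n)
    & forall m n, jacobi_inner alpha (P m) (P n) = ((m == n)%:R)%:E].

Definition consecutive_square_sums (R : realType) (P : nat -> {poly R}) : set R :=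
  [set y | exists (x : R) (n : nat),
     (1 <= n)%N /\ y = (P n).[x] ^+ 2 + (P n.-1).[x] ^+ 2].

(* Main.v *)
(* Write x P_n = a_(n+1) P_(n+1) + a_n P_(n-1).  The Pearson equation of the
   weight determines a_n^2, and
     u_n = a_n^2 (P_n^2 + P_(n-1)^2) - x a_n P_n P_(n-1)
   satisfies u_(n+1) - u_n = (a_(n+1)^2 - a_n^2) P_n^2.
   For alpha >= 1/2 the a_n increase to 1/2, so u_n >= u_1 = a_1^2 P_0^2, and
   u_n <= (P_n^2 + P_(n-1)^2) / 2 on [-1, 1]; off [-1, 1] the |P_n| increase.
   For -1/2 <= alpha < 1/2 the a_n decrease to 1/2, u_n decreases everywhere and
   tends to 0 at 1; at x slightly to the left of 1 there are arbitrarily large n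
   with P_n P_(n-1) <= 0, where P_n^2 + P_(n-1)^2 <= 4 u_n.
   For alpha < -1/2 already P_n(1) tends to 0. *)

Require Import Defs.
From HB Require Import structures.
From mathcomp Require Import all_boot all_order all_algebra.
From mathcomp Require Import all_classical all_reals all_analysis.
From mathcomp Require Import measurable_realfun zify ring lra.

Set Implicit Arguments.
Unset Strict Implicit.
Unset Printing Implicit Defensive.

Import Order.TTheory GRing.Theory Num.Theory.
Import numFieldNormedType.Exports.

Local Open Scope classical_set_scope.
Local Open Scope ring_scope.

(** * Orthonormal polynomials of a linear functional *)

Lemma size_cancel_lead (R : fieldType) (n : nat) (p q : {poly R}) :
  (size p <= n.+1)%N -> size q = n.+1 ->
  (size (p - (p`_n / lead_coef q) *: q)%R <= n)%N.
Proof.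
move=> hp hq; have q0 : lead_coef q != 0 by rewrite lead_coef_eq0 -size_poly_eq0 hq.
apply/leq_sizeP => j; rewrite leq_eqVlt => /predU1P[<-|ltnj].
  have qn : q`_n = lead_coef q by rewrite lead_coefE hq.
  by rewrite coefB coefZ qn divfK// subrr.
have [pj qj] : p`_j = 0 /\ q`_j = 0 by rewrite !nth_default ?hq ?(leq_trans hp).
by rewrite coefB coefZ pj qj mulr0 subr0.
Qed.

Lemma poly_triangular_span (R : fieldType) (P : nat -> {poly R})
    (sizeP : forall n, size (P n) = n.+1) (n : nat) (p : {poly R}) :
  (size p <= n)%N -> exists c : nat -> R, p = \sum_(i < n) c i *: P i.
Proof.
elim: n p => [|n IHn] p hp.
  by exists (fun=> 0); rewrite big_ord0; apply/eqP; rewrite -size_poly_leq0.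
pose d := p`_n / lead_coef (P n).
have [|c hc] := IHn (p - d *: P n).
    exact: size_cancel_lead.
exists (fun i => if i == n then d else c i).
rewrite big_ord_recr/= eqxx -[LHS](subrK (d *: P n)) hc; congr (_ + _).
by apply: eq_bigr => i _; rewrite (ltn_eqF (ltn_ord i)).
Qed.

Section OrthonormalPolynomials.
Context (R : realFieldType) (L : {scalar {poly R}}) (P : nat -> {poly R}).
Hypothesis sizeP : forall n, size (P n) = n.+1.
Hypothesis leadP : forall n, 0 < lead_coef (P n).
Hypothesis orthP : forall m n, L (P m * P n) = (m == n)%:R.

Let LZ c p : L (c *: p) = c * L p. Proof. exact: linearZ. Qed.

Lemma orthonormal_lower (n : nat) (p : {poly R}) :
  (size p <= n)%N -> L (p * P n) = 0.
Proof.
move=> /(poly_triangular_span sizeP)[c ->].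
rewrite mulr_suml linear_sum/= big1// => i _.
by rewrite -scalerAl LZ orthP (ltn_eqF (ltn_ord i)) mulr0.
Qed.

Lemma orthonormal_top (n : nat) (p : {poly R}) :
  (size p <= n.+1)%N -> L (p * P n) = p`_n / lead_coef (P n).
Proof.
move=> hp; have kn0 : lead_coef (P n) != 0 by rewrite gt_eqF.
set d := p`_n / _.
rewrite -[p in LHS](subrK (d *: P n)) mulrDl linearD/= -scalerAl LZ orthP eqxx.
rewrite mulr1 orthonormal_lower ?add0r//.
exact: size_cancel_lead.
Qed.

Lemma orthonormal_eq0 (n : nat) (p : {poly R}) :
  (size p <= n)%N -> (forall i, (i < n)%N -> L (p * P i) = 0) -> p = 0.
Proof.
move=> /(poly_triangular_span sizeP)[c pE] hp.
rewrite pE big1// => i _; have := hp i (ltn_ord i).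
rewrite pE mulr_suml linear_sum/= (bigD1 i)//= big1 => [|j neji].
  by rewrite -scalerAl LZ orthP eqxx mulr1 addr0 => ->; rewrite scale0r.
by rewrite -scalerAl LZ orthP (_ : (j == i :> nat) = false) ?mulr0//; apply: negbTE.
Qed.

(** A Fourier expansion of which only three terms survive. At [n = 0] the index [n.-1] is again 0,
    and the factor [*+ (0 < n)] prevents [P 0] from being counted twice. *)
Lemma orthonormal_tridiag (n : nat) (p : {poly R}) :
  (size p <= n.+2)%N -> (forall i, (i.+1 < n)%N -> L (p * P i) = 0) ->
  p = L (p * P n.+1) *: P n.+1 + L (p * P n) *: P n
      + (L (p * P n.-1) *+ (0 < n)) *: P n.-1.
Proof.
move=> hs hp; apply/eqP; rewrite -subr_eq0; apply/eqP.
apply: (@orthonormal_eq0 n.+2).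
  rewrite (leq_trans (size_polyD _ _))// geq_max hs size_polyN.
  rewrite (leq_trans (size_polyD _ _))// geq_max.
  rewrite (leq_trans (size_polyD _ _)) ?(leq_trans (size_scale_leq _ _)) ?sizeP//=.
    by lia.
  by rewrite geq_max !(leq_trans (size_scale_leq _ _)) ?sizeP.
move=> i ltin; rewrite mulrBl raddfB/= !mulrDl -!scalerAl !(raddfD L)/= !LZ !orthP.
have [->|nei1] := eqVneq i n.+1.
  have [-> ->] : (n == n.+1) = false /\ (n.-1 == n.+1) = false by lia.
  by rewrite mulr1 !mulr0 !addr0 subrr.
have [->|nei] := eqVneq i n.
  case: n {hs hp nei1 ltin} => [|n].
    by rewrite mulr0n mul0r mulr0 mulr1 add0r addr0 subrr.
  by rewrite ltn_eqF//= !mulr0 mulr1 add0r addr0 subrr.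
have [niE|neip] := eqVneq n.-1 i.
  have n0 : (0 < n)%N by lia.
  by rewrite n0 niE mulr1n !mulr0 mulr1 !add0r subrr.
have ltSi : (i.+1 < n)%N by lia.
by rewrite (hp i)// !mulr0 !addr0 subrr.
Qed.

Lemma orthonormal_lead_scale (n : nat) :
  L ('X * P n * P n.+1) = lead_coef (P n) / lead_coef (P n.+1).
Proof.
rewrite orthonormal_top; last first.
  by rewrite mulrC size_mulX ?sizeP// -size_poly_eq0 sizeP.
by rewrite coefXM/= [lead_coef (P n)]lead_coefE sizeP.
Qed.

(* Commuting multiplication by X with (1 - X^2) d/dx, read off at the entries
   (n+1, n) and (n, n) of the Jacobi matrices, forces the diagonal to vanish and
   determines the off-diagonal recursively. *)
Lemma jacobi_recurrence (alpha : R) : -1 < alpha ->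
  (forall p : {poly R},
     L ((1 - 'X^2) * p^`() - (2 * (alpha + 1)) *: ('X * p)) = 0) ->
  exists a : nat -> R,
    [/\ a 0%N = 0, forall n, 0 < a n.+1,
        forall n, 'X * P n = a n.+1 *: P n.+1 + a n *: P n.-1,
        forall n, (1 - 'X^2) * (P n)^`() =
          - (n%:R * a n.+1) *: P n.+1
          + ((n%:R + 2 * alpha + 1) * a n) *: P n.-1
      & forall n, (2 * n%:R + 2 * alpha + 3) * a n.+1 ^+ 2 =
          1 + (2 * n%:R + 2 * alpha - 1) * a n ^+ 2].
Proof.
move=> ha pearson.
(* The value 0 at index 0 makes every term with the truncated index [n.-1] vanish at [n = 0]. *)
pose a n := if n is m.+1 then L ('X * P m * P m.+1) else 0.
pose b n := L ('X * P n * P n).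
pose D (p : {poly R}) := (1 - 'X^2) * p^`().
have DD p q : D (p + q) = D p + D q by rewrite /D derivD mulrDr.
have DZ c p : D (c *: p) = c *: D p by rewrite /D derivZ -scalerAr.
have Pn0 n : P n != 0 by rewrite -size_poly_eq0 sizeP.
have a_gt0 n : 0 < a n.+1 by rewrite /a orthonormal_lead_scale divr_gt0.
have sizeXP n : size ('X * P n) = n.+2 by rewrite mulrC size_mulX// sizeP.
have LXC m n : L ('X * P m * P n) = L ('X * P n * P m) by rewrite mulrAC.
have XP n : 'X * P n = a n.+1 *: P n.+1 + b n *: P n + a n *: P n.-1.
  rewrite [LHS](@orthonormal_tridiag n) ?sizeXP// => [|i ltin].
    by congr (_ + _ + _); case: n => [|n]//=; rewrite mulr1n LXC.
  by rewrite LXC orthonormal_lower// sizeXP.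
(* By [pearson] at [P m * P n] and the product rule, the adjoint of [D] is multiplication by 2
   (alpha + 1) X minus [D]. This yields the diagonal entries of [D], and those below the leading one
   from [D_up]. *)
have adj m n : L (D (P m) * P n) =
    2 * (alpha + 1) * L ('X * P m * P n) - L (D (P n) * P m).
  have := pearson (P m * P n); rewrite derivM linearB/= LZ => /eqP.
  rewrite subr_eq0 mulrDr linearD/= mulrA [P m * (P n)^`()]mulrC !mulrA.
  by move=> /eqP <-; rewrite addrK.
have sizeDP n : (size (D (P n)) <= n.+2)%N.
  rewrite (leq_trans (size_polyMleq _ _))//.
  have h1 : (size (1 - 'X^2 : {poly R})%R <= 3)%N.
    by rewrite (leq_trans (size_polyD _ _))// size_poly1 size_polyN size_polyXn.
  have h2 : (size (P n)^`() <= n)%N by rewrite -ltnS -(sizeP n) lt_size_deriv.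
  by rewrite (_ : n.+2 = (3 + n).-1)// -!subn1 leq_sub2r// leq_add.
have D_up n : L (D (P n) * P n.+1) = - (n%:R * a n.+1).
  rewrite orthonormal_top// /a orthonormal_lead_scale mulrA -mulNr; congr (_ / _).
  rewrite /D mulrBl mul1r coefB [_`_n.+1]nth_default; last first.
    by rewrite -[X in (_ <= X)%N](sizeP n) ltnW ?lt_size_deriv.
  rewrite coefXnM sub0r; congr (- _); case: n => [|n]/=; first by rewrite mul0r.
  by rewrite subSS subn1/= coef_deriv lead_coefE sizeP mulr_natl.
have D_diag n : L (D (P n) * P n) = (alpha + 1) * b n.
  by have := adj n n; rewrite -/(b n) => h; lra.
have D_down n : L (D (P n.+1) * P n) = (n%:R + 2 * alpha + 2) * a n.+1.
  by rewrite adj D_up LXC -/(a n.+1); ring.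
have DP n : D (P n) = - (n%:R * a n.+1) *: P n.+1 + ((alpha + 1) * b n) *: P n
    + ((n%:R + 2 * alpha + 1) * a n) *: P n.-1.
  rewrite [LHS](@orthonormal_tridiag n)// => [|i ltin].
    rewrite D_up D_diag; congr (_ + _ *: _); case: n => [|n]; first by rewrite mulr0n mulr0.
    by rewrite mulr1n D_down -natr1; ring.
  (* After passing to the adjoint, [X * P i] and [D (P i)] have degree at most i + 1 < n. *)
  rewrite adj LXC !orthonormal_lower ?sizeXP ?(leq_trans (sizeDP i))//.
  by rewrite mulr0 subr0.
have comm n : D ('X * P n) = (1 - 'X^2) * P n + 'X * D (P n).
  by rewrite /D derivM derivX mul1r; ring.
have DXP n q : L (D ('X * P n) * q) = a n.+1 * L (D (P n.+1) * q)
    + b n * L (D (P n) * q) + a n * L (D (P n.-1) * q).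
  by rewrite XP !DD !DZ !mulrDl -!scalerAl !linearD/= !LZ.
have XXP n q : L ('X * (P n) * ('X * q)) = a n.+1 * L ('X * P n.+1 * q)
    + b n * L ('X * P n * q) + a n * L ('X * P n.-1 * q).
  rewrite {1}XP !mulrDl -!scalerAl !linearD/= !LZ.
  by rewrite !(mulrCA _ 'X) !mulrA.
have XDP n q : L ('X * D (P n) * q) = - (n%:R * a n.+1) * L ('X * P n.+1 * q)
    + (alpha + 1) * b n * L ('X * P n * q)
    + (n%:R + 2 * alpha + 1) * a n * L ('X * P n.-1 * q).
  rewrite DP; move: (- _) (_ * b n) (_ * a n) => c d e.
  by rewrite !mulrDr !mulrDl -!scalerAr -!scalerAl !linearD/= !LZ.
have commL n q : L (D ('X * P n) * q) =
    L (P n * q) - L ('X * P n * ('X * q)) + L ('X * D (P n) * q).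
  rewrite comm -linearB -linearD/=; congr (L _); ring.
have b0 n : b n = 0.
  elim: n => [|n IHn].
    have /eqP : L (D (P 0%N) * P 0%N) = 0.
      by rewrite /D (size1_polyC (_ : size (P 0%N) <= 1)%N) ?sizeP// derivC mulr0 mul0r linear0.
    by rewrite D_diag mulf_eq0 => /predU1P[|/eqP//]; lra.
  have aD : a n * L (D (P n.-1) * P n.+1) = 0.
    by case: n {IHn} => [|n]; rewrite ?mul0r// orthonormal_lower ?mulr0.
  have aX : a n * L ('X * P n.-1 * P n.+1) = 0.
    by case: n {IHn aD} => [|n]; rewrite ?mul0r// orthonormal_lower ?mulr0 ?sizeXP.
  (* Since b_n = 0 by induction, this entry of the commutator relation reads a_(n+1) (n + alpha + 2)
     b_(n+1) = 0, and the first two factors are positive. *)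
  have := commL n (P n.+1).
  rewrite DXP XXP XDP aD aX IHn -!(mulrA _ (a n)) aX D_diag orthP ltn_eqF// -/(b n.+1) => h.
  have : a n.+1 * ((n%:R + alpha + 2) * b n.+1) = 0.
    by move: h => /=; nra.
  move/eqP; rewrite mulf_eq0 (gt_eqF (a_gt0 n))/= mulf_eq0 => /predU1P[|/eqP//].
  by have := ler0n R n; lra.
exists a; split=> [//|//|n|n|n].
- by rewrite {1}XP b0 scale0r addr0.
- by rewrite -/(D _) DP b0 mulr0 scale0r addr0.
have aD : a n * L (D (P n.-1) * P n) = - (n%:R - 1) * a n ^+ 2.
  case: n => [|n]; first by rewrite /a expr0n mul0r mulr0.
  by rewrite D_up -natr1; ring.
have aX : a n * L ('X * P n.-1 * P n) = a n ^+ 2.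
  by case: n {aD} => [|n]; rewrite ?expr2// /a !mul0r.
have := commL n (P n).
rewrite DXP XXP XDP aD aX b0 -!(mulrA _ (a n)) aX D_down orthP eqxx LXC -/(a n.+1).
by rewrite mulr1n; move: (a n.+1) (a n) => s t h; lra.
Qed.

End OrthonormalPolynomials.

(** * Turan determinants *)

(* The relative decrements dominate those of a harmonic series, so v drops by a
   fixed amount over each dyadic block on which it stays above e. *)
Lemma harmonic_decay (R : archiRealFieldType) (v : nat -> R) (d e : R) (N : nat) :
  0 < d -> 0 < e -> (forall n, (N <= n)%N -> 0 <= v n) ->
  (forall n, (N <= n)%N -> d * v n <= n%:R * (v n - v n.+1)) ->
  exists2 n, (N <= n)%N & v n < e.
Proof.
move=> d0 e0 v0 vS; apply: contrapT => Hn.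
have ve n : (N <= n)%N -> e <= v n.
  by move=> Nn; rewrite leNgt; apply/negP => h; apply: Hn; exists n.
have block m k : (N < m)%N -> (k <= m)%N -> v (m + k)%N <= v m - k%:R * (d * e / (2 * m%:R)).
  move=> Nm; elim: k => [|k IHk] km; first by rewrite addn0 mul0r subr0.
  have m0 : 0 < m%:R :> R by rewrite ltr0n; lia.
  have mk0 : 0 < (m + k)%:R :> R by rewrite ltr0n; lia.
  have step : v (m + k).+1 <= v (m + k)%N - d * e / (2 * m%:R).
    have h1 : v (m + k).+1 <= v (m + k)%N - d * v (m + k)%N / (m + k)%:R.
      rewrite lerBrDr -lerBrDl ler_pdivrMr// [leRHS]mulrC.
      by apply: vS; lia.
    apply: (le_trans h1); rewrite lerD2l lerN2.
    rewrite ler_pM ?mulr_ge0 ?invr_ge0 ?(ltW d0) ?(ltW e0) ?ler0n//.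
      by rewrite ler_pM2l// ve//; lia.
    rewrite lef_pV2 ?posrE ?mulr_gt0// natrD.
    by have : k%:R <= m%:R :> R; [rewrite ler_nat; lia|lra].
  have IH : v (m + k)%N <= v m - k%:R * (d * e / (2 * m%:R)) by apply: IHk; lia.
  by move: step IH; rewrite addnS -[k.+1%:R]natr1; move: (_ / _) => X; lra.
(* A block from m to 2m lowers [v] by m times d e / (2 m), which does not depend on m. Starting at
   [N.+1] keeps m positive and above [N]. *)
have dyadic j : v (2 ^ j * N.+1)%N <= v N.+1 - j%:R * (d * e / 2).
  elim: j => [|j IHj]; first by rewrite expn0 mul1n mul0r subr0.
  have pj : (0 < 2 ^ j)%N by rewrite expn_gt0.
  have -> : (2 ^ j.+1 * N.+1 = 2 ^ j * N.+1 + 2 ^ j * N.+1)%N by rewrite expnS; lia.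
  have m0 : ((2 ^ j * N.+1)%N%:R : R) != 0 by rewrite pnatr_eq0; lia.
  apply: (le_trans (block _ _ _ _)) => //; first by nia.
  have -> : (2 ^ j * N.+1)%:R * (d * e / (2 * (2 ^ j * N.+1)%:R)) = d * e / 2 :> R.
    by move: m0; move: ((2 ^ j * N.+1)%N%:R : R) => M M0; field.
  by move: IHj; rewrite -[j.+1%:R]natr1; lra.
have de0 : 0 < d * e / 2 by rewrite !mulr_gt0// invr_gt0.
have vN0 : 0 <= v N.+1 by apply: v0.
have := archi_boundP (divr_ge0 vN0 (ltW de0)); set j := Num.bound _.
rewrite ltr_pdivrMr// => hj.
have : 0 <= v (2 ^ j * N.+1)%N by apply: v0; have : (0 < 2 ^ j)%N by [rewrite expn_gt0]; nia.
by have := dyadic j; lra.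
Qed.

Section JacobiTuran.
Context (R : realType) (alpha : R) (a : nat -> R) (P : nat -> {poly R}).
Hypothesis alpha_gtN1 : -1 < alpha.
Hypothesis a0 : a 0%N = 0.
Hypothesis a_gt0 : forall n, 0 < a n.+1.
Hypothesis recP : forall n x,
  x * (P n).[x] = a n.+1 * (P n.+1).[x] + a n * (P n.-1).[x].
Hypothesis rec_sq_a : forall n,
  (2 * n%:R + 2 * alpha + 3) * a n.+1 ^+ 2 =
  1 + (2 * n%:R + 2 * alpha - 1) * a n ^+ 2.
(** This is the derivative relation at the point 1, where the factor 1 - X^2 vanishes. *)
Hypothesis P_at1 : forall n,
  n%:R * (a n.+1 * (P n.+1).[1]) = (n%:R + 2 * alpha + 1) * (a n * (P n.-1).[1]).

(* By the recurrence this is a_n (a_n P_n^2 - a_(n+1) P_(n-1) P_(n+1)), a Turan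
   determinant written without the index n+1. *)
Definition turan (n : nat) (x : R) : R :=
  a n ^+ 2 * ((P n).[x] ^+ 2 + (P n.-1).[x] ^+ 2)
  - x * (a n * (P n).[x]) * (P n.-1).[x].

Lemma turan_step n x :
  turan n.+1 x = turan n x + (a n.+1 ^+ 2 - a n ^+ 2) * (P n).[x] ^+ 2.
Proof.
have t : a n.+1 * (P n.+1).[x] = x * (P n).[x] - a n * (P n.-1).[x].
  by rewrite recP addrK.
by rewrite /turan/= mulrDr -exprMn t; ring.
Qed.

Lemma turan1 x : turan 1 x = a 1%N ^+ 2 * (P 0%N).[x] ^+ 2.
Proof. by rewrite turan_step /turan a0; ring. Qed.

Lemma rec_sq_a_step n :
  (2 * n%:R + 2 * alpha + 3) * (a n.+1 ^+ 2 - a n ^+ 2) = 1 - 4 * a n ^+ 2.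
Proof. by rewrite mulrBr rec_sq_a; ring. Qed.

(** The closed form of a_n^2, with denominators cleared because a factor may vanish, as 2 n + 2
    alpha - 1 does for n = 1 and alpha = -1/2. *)
Lemma sq_a_product n :
  (2 * n%:R + 2 * alpha + 1) * (2 * n%:R + 2 * alpha - 1) * a n ^+ 2 =
  n%:R * (n%:R + 2 * alpha).
Proof.
case: n => [|n]; first by rewrite a0; ring.
elim: n => [|n IHn].
  have := rec_sq_a 0%N; rewrite a0 => h.
  transitivity ((2 * alpha + 1) * ((2 * 0%:R + 2 * alpha + 3) * a 1%N ^+ 2)).
    by ring.
  by rewrite h; ring.
have h := rec_sq_a n.+1.
transitivity ((2 * n.+1%:R + 2 * alpha + 1) *
    ((2 * n.+1%:R + 2 * alpha + 3) * a n.+2 ^+ 2)).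
  by rewrite -[n.+2%:R]natr1; ring.
by rewrite h mulrDr mulr1 mulrA IHn -[n.+2%:R]natr1; ring.
Qed.

(** By the recursion, 4 a_(n+1)^2 is a mean of 1 and 4 a_n^2 with weights 4 and 2 n + 2 alpha - 1,
    both nonnegative here, so the bound propagates. With [rec_sq_a_step] it says that a_n^2
    increases. *)
Lemma sq_a_le_quarter n : 2^-1 <= alpha -> 4 * a n ^+ 2 <= 1.
Proof.
move=> ha; elim: n => [|n IHn]; first by rewrite a0; lra.
have h := rec_sq_a n; have n0 : 0 <= n%:R :> R by [].
rewrite -(ler_pM2l (_ : 0 < 2 * n%:R + 2 * alpha + 3)); last by lra.
case: n IHn h n0 => [|n] IHn h n0; first by rewrite mulrCA h a0; lra.
rewrite mulrCA h; have : 1 <= n.+1%:R :> R by rewrite ler1n.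
by nra.
Qed.

(** The same mean propagates the reverse bound from 4 a_1^2 = 4 / (2 alpha + 3) >= 1; for n >= 1 the
    weight 2 n + 2 alpha - 1 is nonnegative because alpha >= -1/2. *)
Lemma sq_a_ge_quarter n : - 2^-1 <= alpha -> alpha < 2^-1 -> 1 <= 4 * a n.+1 ^+ 2.
Proof.
move=> ha ha'; elim: n => [|n IHn].
  by have := rec_sq_a 0%N; rewrite a0; nra.
have h := rec_sq_a n.+1; have n0 : 1 <= n.+1%:R :> R by rewrite ler1n.
rewrite -(ler_pM2l (_ : 0 < 2 * n.+1%:R + 2 * alpha + 3)); last by lra.
by rewrite mulrCA h; nra.
Qed.

(** * The lower bound for alpha >= 1/2 *)

Lemma sum_sqr_lower_bound n x : 2^-1 <= alpha ->
  (forall x, 1 <= (P 0%N).[x] ^+ 2) ->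
  2 / (2 * alpha + 3) <= (P n.+1).[x] ^+ 2 + (P n).[x] ^+ 2.
Proof.
move=> ha hP0.
have a1 : a 1%N ^+ 2 = (2 * alpha + 3)^-1.
  have c0 : 2 * alpha + 3 != 0 by rewrite lt0r_neq0//; lra.
  by apply: (mulfI c0); rewrite mulfV//; have := rec_sq_a 0%N; rewrite a0; lra.
have a_le n' : a n' <= 2^-1.
  have := sq_a_le_quarter n' ha; case: n' => [|n']; first by rewrite a0; lra.
  by have := a_gt0 n'; nra.
have [x1|x1] := leP `|x| 1.
  have mono k : a 1%N ^+ 2 <= turan k.+1 x.
    elim: k => [|k IHk]; first by rewrite turan1 ler_peMr ?sqr_ge0.
    rewrite turan_step (le_trans IHk)// lerDl mulr_ge0 ?sqr_ge0//.
    have := rec_sq_a_step k.+1; have := sq_a_le_quarter k.+1 ha.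
    by have : 0 <= k.+1%:R :> R by []; nra.
  have := mono n; rewrite a1 /turan/=.
  move=> h.
  have aq := sq_a_le_quarter n.+1 ha.
  have xa : `|x * a n.+1| <= 2^-1.
    rewrite normrM (gtr0_norm (a_gt0 n)).
    by have := a_le n.+1; have := a_gt0 n; have := normr_ge0 x; nra.
  move: xa; rewrite ler_norml => /andP[xa1 xa2].
  have aS : 4 * a n.+1 ^+ 2 * ((P n.+1).[x] ^+ 2 + (P n).[x] ^+ 2) <=
      1 * ((P n.+1).[x] ^+ 2 + (P n).[x] ^+ 2).
    by rewrite ler_wpM2r// addr_ge0 ?sqr_ge0.
  (* Write S for the sum of the two squares. Adding [h1] and [h2] bounds the cross term of the Turan
     determinant by S / 4, and [aS] bounds the rest by S / 4, so that the determinant is at most S /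
     2. *)
  have h1 : 0 <= (2^-1 + x * a n.+1) * ((P n.+1).[x] + (P n).[x]) ^+ 2.
    by rewrite mulr_ge0 ?sqr_ge0//; lra.
  have h2 : 0 <= (2^-1 - x * a n.+1) * ((P n.+1).[x] - (P n).[x]) ^+ 2.
    by rewrite mulr_ge0 ?sqr_ge0//; lra.
  by lra.
have grow k : 1 <= `|(P k).[x]| /\ `|(P k).[x]| <= `|(P k.+1).[x]|.
  (* The factor [a k'] makes the assumption trivial at [k' = 0]. As |x| > 1 and the coefficients are
     at most 1/2, the recurrence gives a_(k+1) |P_(k+1)| >= |P_k| / 2 >= a_(k+1) |P_k|. *)
  have step k' : a k' * `|(P k'.-1).[x]| <= a k' * `|(P k').[x]| ->
      `|(P k').[x]| <= `|(P k'.+1).[x]|.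
    move=> hk; have ak1 := a_gt0 k'; have hk1 := a_le k'.+1.
    have hk2 := a_le k'; have ak : 0 <= a k' by case: (k') => [|m]; [rewrite a0|exact: ltW].
    have : `|x| * `|(P k').[x]| <= a k'.+1 * `|(P k'.+1).[x]| + a k' * `|(P k'.-1).[x]|.
      rewrite -normrM recP (le_trans (ler_normD _ _))// !normrM.
      by rewrite (gtr0_norm ak1) (ger0_norm ak).
    have := normr_ge0 ((P k').[x]); have := normr_ge0 ((P k'.+1).[x]).
    move: hk; move: (`|x|) (`|(P k').[x]|) (`|(P k'.+1).[x]|) (`|(P k'.-1).[x]|) x1.
    move=> X u v w X1 hk v0 u0 h.
    rewrite -(ler_pM2l ak1); nra.
  elim: k => [|k [IH1 IH2]].
    split; last by apply: step; rewrite a0 !mul0r.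
    have := hP0 x; rewrite -real_normK ?num_real//.
    by have := normr_ge0 ((P 0%N).[x]); nra.
  split; first exact: le_trans IH2.
  by apply: step; rewrite ler_pM2l.
have [h1 h2] := grow n.
have h3 : 1 <= (P n).[x] ^+ 2 by rewrite -[_ ^+ 2]real_normK ?num_real//; nra.
have h4 : 1 <= (P n.+1).[x] ^+ 2 by rewrite -[_ ^+ 2]real_normK ?num_real//; nra.
by rewrite ler_pdivrMr; [nra|lra].
Qed.

(** * Exact recursions at the endpoint 1 *)

Lemma P_at1_first_order n :
  n%:R * (P n).[1] = (2 * n%:R + 2 * alpha + 1) * (a n * (P n.-1).[1]).
Proof.
have := recP n 1; rewrite mul1r => ->.
by rewrite mulrDr P_at1; ring.
Qed.

(** Squaring the first-order recursion leaves the coefficient only as a_(n+1)^2, which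
    [sq_a_product] makes rational in n. *)
Lemma sqr_P_at1 n :
  n.+1%:R * (2 * n%:R + 2 * alpha + 1) * (P n.+1).[1] ^+ 2 =
  (2 * n%:R + 2 * alpha + 3) * (n.+1%:R + 2 * alpha) * (P n).[1] ^+ 2.
Proof.
have n0 : n.+1%:R != 0 :> R by rewrite pnatr_eq0.
have h := P_at1_first_order n.+1; have hA := sq_a_product n.+1.
apply: (mulfI n0); rewrite /= in h.
transitivity ((2 * n%:R + 2 * alpha + 1) * (n.+1%:R * (P n.+1).[1]) ^+ 2).
  by ring.
rewrite h; transitivity ((2 * n%:R + 2 * alpha + 3) *
    ((2 * n.+1%:R + 2 * alpha + 1) * (2 * n.+1%:R + 2 * alpha - 1) * a n.+1 ^+ 2)
    * (P n).[1] ^+ 2).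
  by rewrite -[n.+1%:R]natr1; ring.
by rewrite hA; ring.
Qed.

(** The recursions at 1 reduce all three terms of the determinant to a multiple of P_n(1)^2. The
    factor 2 alpha + 1 shows that the determinant is nonnegative for alpha >= -1/2 and n >= 1. *)
Lemma turan_at1 n :
  n.+1%:R * (2 * n%:R + 2 * alpha + 1) * turan n.+1 1 =
  (2 * alpha + 1) * a n.+1 ^+ 2 * (P n).[1] ^+ 2.
Proof.
have h1 := sqr_P_at1 n; have /= h2 := P_at1_first_order n.+1.
rewrite /turan/=.
transitivity (a n.+1 ^+ 2 * (n.+1%:R * (2 * n%:R + 2 * alpha + 1) * (P n.+1).[1] ^+ 2)
  + n.+1%:R * (2 * n%:R + 2 * alpha + 1) * a n.+1 ^+ 2 * (P n).[1] ^+ 2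
  - (2 * n%:R + 2 * alpha + 1) * a n.+1 * (P n).[1] * (n.+1%:R * (P n.+1).[1])).
  by ring.
by rewrite h1 h2 -[n.+1%:R]natr1; ring.
Qed.

(** The relative decrement of the determinant at 1 is asymptotic to (1 - 2 alpha) / n, the form that
    [harmonic_decay] requires. *)
Lemma turan_at1_decrement n : (0 < n)%N ->
  (2 * n%:R + 2 * alpha + 5) * (n.+1%:R * (turan n.+1 1 - turan n.+2 1)) =
  (1 - 2 * alpha) * (2 * n%:R + 2 * alpha + 3) * turan n.+1 1.
Proof.
have agt := alpha_gtN1.
move=> n0; have n1 : 1 <= n%:R :> R by rewrite ler1n.
have K0 : n.+1%:R * (2 * n%:R + 2 * alpha + 1) * n.+1%:R != 0 :> R.
  by rewrite !mulf_neq0 ?pnatr_eq0// lt0r_neq0//; lra.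
have K1 : 2 * n%:R + 2 * alpha + 3 != 0 by rewrite lt0r_neq0//; lra.
have hA := sq_a_product n.+1; have hs := rec_sq_a_step n.+1.
have /= h2 := P_at1_first_order n.+1; have ht := turan_at1 n.
apply: (mulfI K0); rewrite [turan n.+2 1]turan_step opprD addNKr.
transitivity (- (2 * n%:R + 2 * alpha + 1) *
    ((2 * n.+1%:R + 2 * alpha + 3) * (a n.+2 ^+ 2 - a n.+1 ^+ 2)) *
    (n.+1%:R * (P n.+1).[1]) ^+ 2 * n.+1%:R).
  by rewrite -[n.+1%:R]natr1; ring.
rewrite hs h2.
transitivity ((1 - 2 * alpha) * (2 * n%:R + 2 * alpha + 3) * n.+1%:R *
    (n.+1%:R * (2 * n%:R + 2 * alpha + 1) * turan n.+1 1)); last by ring.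
rewrite ht.
(* With m = n + 1, the closed form gives (2 m + 2 alpha + 1) (2 m + 2 alpha - 1) (4 a_m^2 - 1) = 1 -
   4 alpha^2, whose factor 1 + 2 alpha is the one from [turan_at1]. *)
have -> : - (2 * n%:R + 2 * alpha + 1) * (1 - 4 * a n.+1 ^+ 2) *
    ((2 * n.+1%:R + 2 * alpha + 1) * (a n.+1 * (P n).[1])) ^+ 2 * n.+1%:R =
  (4 * ((2 * n.+1%:R + 2 * alpha + 1) * (2 * n.+1%:R + 2 * alpha - 1) * a n.+1 ^+ 2)
    - (2 * n.+1%:R + 2 * alpha + 1) * (2 * n.+1%:R + 2 * alpha - 1)) *
  (2 * n%:R + 2 * alpha + 3) * a n.+1 ^+ 2 * (P n).[1] ^+ 2 * n.+1%:R.
  by rewrite -[n.+1%:R]natr1; ring.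
by rewrite hA -[n.+1%:R]natr1; ring.
Qed.

(** * Arbitrarily small sums for alpha < 1/2 *)

Lemma sum_sqr_small_at1 (e : R) : alpha < - 2^-1 -> 0 < e ->
  exists n, (P n.+1).[1] ^+ 2 + (P n).[1] ^+ 2 < e.
Proof.
have agt := alpha_gtN1.
move=> ha e0; pose v n := (P n).[1] ^+ 2.
have v0 n : 0 <= v n by rewrite sqr_ge0.
(* By [sqr_P_at1] the relative decrement is asymptotic to -(2 alpha + 1) / n; half of this constant
   works for every n >= 1. *)
have vS n : (1 <= n)%N -> - (alpha + 2^-1) * v n <= n%:R * (v n - v n.+1).
  rewrite -(ler1n R) => n1.
  have c1 : 0 < 2 * n%:R + 2 * alpha + 1 by lra.
  have h : n.+1%:R * ((2 * n%:R + 2 * alpha + 1) * (v n - v n.+1)) =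
      - (2 * alpha + 1) * (2 * n%:R + 2 * alpha + 2) * v n.
    have := sqr_P_at1 n; rewrite -/(v n) -/(v n.+1) -[n.+1%:R]natr1 => h.
    transitivity ((n%:R + 1) * (2 * n%:R + 2 * alpha + 1) * v n -
      (n%:R + 1) * (2 * n%:R + 2 * alpha + 1) * v n.+1); first by ring.
    by rewrite h; ring.
  have c2 : 0 < n.+1%:R * (2 * n%:R + 2 * alpha + 1) by rewrite mulr_gt0.
  rewrite -(ler_pM2l c2).
  have -> : n.+1%:R * (2 * n%:R + 2 * alpha + 1) * (n%:R * (v n - v n.+1)) =
      n%:R * (n.+1%:R * ((2 * n%:R + 2 * alpha + 1) * (v n - v n.+1))) by ring.
  rewrite h -[n.+1%:R]natr1.
  rewrite -subr_ge0; set d := _ - _.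
  have -> : d = - (2 * alpha + 1) * v n *
      (n%:R * (2 * n%:R + 2 * alpha + 2) - (n%:R + 1) * (2 * n%:R + 2 * alpha + 1) / 2).
    by rewrite /d; field.
  apply: mulr_ge0; first by apply: mulr_ge0 => //; lra.
  by nra.
have [||||n n1 vn] := @harmonic_decay R v (- (alpha + 2^-1)) (e / 2) 1%N.
- by lra.
- by rewrite divr_gt0.
- by [].
- exact: vS.
exists n; have := vS n n1; rewrite -/(v n) -/(v n.+1) => h.
suff : v n.+1 <= v n by lra.
have n0 : 1 <= n%:R :> R by rewrite ler1n.
have : 0 <= - (alpha + 2^-1) * v n by rewrite mulr_ge0//; lra.
by nra.
Qed.

(** If all products were positive from N on, the ratios r_n = P_(n+1) / P_n would stay positive. But
    coefficients of at least 1/2 give r_(n+1) <= 2 x - 1 / r_n, and so r_n would drop by at least 2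
    (1 - x) at each step. *)
Lemma sign_change_left_of1 (x : R) (N : nat) :
  (forall n, 1 <= 4 * a n.+1 ^+ 2) -> 0 < x < 1 ->
  exists2 n, (N <= n)%N & (P n.+1).[x] * (P n).[x] <= 0.
Proof.
move=> ha /andP[x0 x1]; apply: contrapT => H.
have a_ge n : 2^-1 <= a n.+1 by have := ha n; have := a_gt0 n; nra.
have pos n : (N <= n)%N -> 0 < (P n.+1).[x] * (P n).[x].
  by move=> Nn; rewrite ltNge; apply/negP => h; apply: H; exists n.
pose r n := (P n.+1).[x] / (P n).[x].
have r0 n : (N <= n)%N -> 0 < r n.
  move=> /pos; rewrite /r; set u := _.[x]; set v := _.[x] => uv.
  have v0 : v != 0 by apply: contraTneq uv => ->; rewrite mulr0 ltxx.
  have -> : u / v = u * v / v ^+ 2 by field.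
  by rewrite divr_gt0// exprn_even_gt0.
have rS n : (N <= n)%N -> r n.+1 <= r n - 2 * (1 - x).
  move=> Nn; have rn := r0 _ Nn; have rn1 := r0 n.+1 (leqW Nn).
  have P1 : (P n.+1).[x] != 0.
    by apply: contraTneq (pos _ Nn) => ->; rewrite mul0r ltxx.
  have P0 : (P n).[x] != 0.
    by apply: contraTneq (pos _ Nn) => ->; rewrite mulr0 ltxx.
  have eqr : a n.+2 * r n.+1 = x - a n.+1 / r n.
    have -> : a n.+2 * r n.+1 = (x * (P n.+1).[x] - a n.+1 * (P n).[x]) / (P n.+1).[x].
      by rewrite recP/= addrK mulrA.
    by rewrite /r; field; rewrite P0 P1.
  have h1 : 2^-1 * r n.+1 <= a n.+2 * r n.+1 by rewrite ler_wpM2r// ltW.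
  have h2 : 2^-1 / r n <= a n.+1 / r n by rewrite ler_wpM2r// invr_ge0 ltW.
  (* The tangent to the convex function 1 / r at r = 1. *)
  have h3 : 2 - r n <= (r n)^-1.
    by rewrite -(ler_pM2l rn) divff ?lt0r_neq0//; have := sqr_ge0 (r n - 1); lra.
  by lra.
have rB k : r (N + k)%N <= r N - k%:R * (2 * (1 - x)).
  elim: k => [|k IHk]; first by rewrite addn0 mul0r subr0.
  have := rS (N + k)%N (leq_addr _ _); rewrite addnS -[k.+1%:R]natr1; lra.
have d0 : 0 < 2 * (1 - x) by lra.
have := archi_boundP (divr_ge0 (ltW (r0 _ (leqnn N))) (ltW d0)).
set k := Num.bound _; rewrite ltr_pdivrMr// => hk.
by have := rB k; have := r0 (N + k)%N (leq_addr _ _); lra.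
Qed.

Lemma sum_sqr_small_near1 (e : R) : - 2^-1 <= alpha -> alpha < 2^-1 -> 0 < e ->
  exists x n, (P n.+1).[x] ^+ 2 + (P n).[x] ^+ 2 < e.
Proof.
move=> ha ha' e0.
have a4 n := sq_a_ge_quarter n ha ha'.
have [||n n1|n n1|m m2 um] :=
    @harmonic_decay R (turan ^~ 1) (2^-1 - alpha) (e / 4) 2.
- by lra.
- by rewrite divr_gt0.
- case: n n1 => [//|n n1].
  have n0 : 1 <= n%:R :> R by rewrite ler1n.
  have c0 : 0 < n.+1%:R * (2 * n%:R + 2 * alpha + 1) by rewrite mulr_gt0//; lra.
  rewrite -(pmulr_rge0 _ c0) turan_at1.
  by rewrite mulr_ge0 ?sqr_ge0// mulr_ge0 ?sqr_ge0//; lra.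
- have n0 : (0 < n.-1)%N by lia.
  case: n n1 n0 => [//|n] /= _ n0.
  have n1 : 1 <= n%:R :> R by rewrite ler1n.
  have c0 : 0 < n.+1%:R * (2 * n%:R + 2 * alpha + 1) by rewrite mulr_gt0//; lra.
  have u0 : 0 <= turan n.+1 1.
    rewrite -(pmulr_rge0 _ c0) turan_at1.
    by rewrite mulr_ge0 ?sqr_ge0// mulr_ge0 ?sqr_ge0//; lra.
  have c5 : 0 < 2 * n%:R + 2 * alpha + 5 by lra.
  rewrite -(ler_pM2l c5) turan_at1_decrement//.
  rewrite mulrA ler_wpM2r//; nra.
(* The determinant as a polynomial in x: by continuity its smallness at 1 persists at some x in ]0,
   1[. *)
pose U : {poly R} := (a m ^+ 2) *: (P m ^+ 2 + P m.-1 ^+ 2) - (a m) *: ('X * P m * P m.-1).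
have UE x : U.[x] = turan m x by rewrite /U /turan !hornerE/=; ring.
have [x [x01 ux]] : exists x, 0 < x < 1 /\ turan m x < e / 4.
  have cU : {for 1, continuous (horner U)} by apply: continuous_horner.
  have /cU : nbhs (U.[1]) [set y | y < e / 4] by rewrite UE; apply: lt_nbhsl.
  move=> /nbhs_ballP[d /= d0 dU].
  exists (1 - Num.min d 1 / 2); split.
    have : 0 < Num.min d 1 by rewrite lt_min d0 ltr01.
    have : Num.min d 1 <= 1 by rewrite ge_min lexx orbT.
    by lra.
  rewrite -UE; apply: dU; rewrite /ball/= opprB addrC subrK.
  have m0 : 0 < Num.min d 1 by rewrite lt_min d0 ltr01.
  have md : Num.min d 1 <= d by rewrite ge_min lexx.
  by rewrite gtr0_norm ?divr_gt0//; lra.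
have umono k : turan (m + k)%N x <= turan m x.
  elim: k => [|k IHk]; first by rewrite addn0.
  rewrite addnS turan_step (le_trans _ IHk)// gerDl mulr_le0_ge0 ?sqr_ge0//.
  have -> : (m + k = (m + k).-1.+1)%N by lia.
  have := rec_sq_a_step (m + k).-1.+1; have := a4 (m + k).-1.
  by have : 1 <= (m + k).-1.+1%:R :> R; [rewrite ler1n|nra].
have [n mn PP] := sign_change_left_of1 m a4 x01.
exists x, n; have := umono (n.+1 - m)%N; rewrite subnKC ?leqW// => un.
have /andP[x0 x1] := x01.
have xPP : x * (a n.+1 * (P n.+1).[x]) * (P n).[x] <= 0.
  have -> : x * (a n.+1 * (P n.+1).[x]) * (P n).[x] =
    (x * a n.+1) * ((P n.+1).[x] * (P n).[x]) by ring.
  by rewrite mulr_ge0_le0// mulr_ge0// ltW.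
have S0 : 0 <= (P n.+1).[x] ^+ 2 + (P n).[x] ^+ 2 by rewrite addr_ge0 ?sqr_ge0.
have := ler_wpM2r S0 (a4 n); move: un; rewrite {1}/turan/= => un aS.
by lra.
Qed.

End JacobiTuran.

(** * The Jacobi weight *)

Section JacobiWeight.
Context (R : realType).
Notation mu := (@lebesgue_measure R).

Lemma one_subr_sqr_gt0 (x : R) : x \in `](-1), 1[ -> 0 < 1 - x ^+ 2.
Proof. by rewrite in_itv/= => /andP[x1 x2]; nra. Qed.

Lemma is_derive_one_subr_sqr_powR (b x : R) : x \in `](-1), 1[ ->
  is_derive x 1 (fun y => (1 - y ^+ 2) `^ b) (- 2 * b * x * (1 - x ^+ 2) `^ (b - 1)).
Proof.
move=> /one_subr_sqr_gt0 x1.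
have d1 : is_derive x 1 (fun y : R => 1 - y ^+ 2) (- (2 * x)).
  by apply: is_derive_eq; rewrite /GRing.scale/=; ring.
have d2 := is_derive1_powR b x1.
have := @is_derive1_comp R (fun z => z `^ b) (fun y : R => 1 - y ^+ 2) x _ _ d2 d1.
by move=> h; apply: is_derive_eq; ring.
Qed.

Lemma is_derive_pearson (al x : R) (p : {poly R}) : x \in `](-1), 1[ ->
  is_derive x 1 (fun y => p.[y] * (1 - y ^+ 2) `^ (al + 1))
    (((1 - 'X^2) * p^`() - (2 * (al + 1)) *: ('X * p)).[x] * (1 - x ^+ 2) `^ al).
Proof.
move=> x1; have x2 := one_subr_sqr_gt0 x1.
have d1 := is_derive_one_subr_sqr_powR (al + 1) x1.
have d2 : is_derive x 1 (horner p) p^`().[x].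
  by apply: DeriveDef; [exact: derivable_horner|rewrite -derive1E derivE].
apply: is_derive_eq; rewrite /GRing.scale/= addrK !hornerE.
by rewrite powRD ?(gt_eqF x2) ?implybT// powRr1 ?(ltW x2)//=; ring.
Qed.

Lemma cvg_pearson_right (b : R) (p : {poly R}) : 0 < b ->
  p.[y] * (1 - y ^+ 2) `^ b @[y --> (-1)^'+] --> (0 : R).
Proof.
move=> b0; rewrite -(mulr0 p.[-1]); apply: cvgM.
  by apply: cvg_at_right_filter; exact: continuous_horner.
apply: (@increasing_cvg_at_right_comp R (fun y => 1 - y ^+ 2) (fun z => z `^ b)
  (-1) (BRight 0) 0).
- by rewrite bnd_simp; lra.
- by move=> y z; rewrite !in_itv/= => /andP[y1 y2] /andP[z1 z2] yz; nra.
- apply: cvg_at_right_filter; apply: cvgB; first exact: cvg_cst.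
  exact: exprn_continuous.
- by rewrite sqrrN expr1n subrr; exact: powR_cvg0.
Qed.

Lemma cvg_pearson_left (b : R) (p : {poly R}) : 0 < b ->
  p.[y] * (1 - y ^+ 2) `^ b @[y --> 1^'-] --> (0 : R).
Proof.
move=> b0; rewrite -(mulr0 p.[1]); apply: cvgM.
  by apply: cvg_at_left_filter; exact: continuous_horner.
apply: (@decreasing_cvg_at_left_comp R (fun y => 1 - y ^+ 2) (fun z => z `^ b)
  (BLeft 0) 1 0).
- by rewrite bnd_simp; lra.
- by move=> y z; rewrite !in_itv/= => /andP[y1 y2] /andP[z1 z2] yz; nra.
- apply: cvg_at_left_filter; apply: cvgB; first exact: cvg_cst.
  exact: exprn_continuous.
- by rewrite expr1n subrr; exact: powR_cvg0.
Qed.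

Lemma Rintegral_pearson (al : R) (p : {poly R}) : -1 < al ->
  let f := fun x => ((1 - 'X^2) * p^`() - (2 * (al + 1)) *: ('X * p)).[x]
    * (1 - x ^+ 2) `^ al in
  mu.-integrable `[(-1), 1] (EFin \o f) ->
  \int[mu]_(x in `[(-1), 1]) f x = 0.
Proof.
move=> al1 f intf.
pose F x := p.[x] * (1 - x ^+ 2) `^ (al + 1).
have dF (x : R) : x \in `](-1), 1[ -> is_derive x 1 F (f x).
  exact: is_derive_pearson.
have cF (x : R) : x \in `](-1), 1[ -> {for x, continuous F}.
  by move=> /dF[+ _] => /derivable1_diffP/differentiable_continuous.
have cf (x : R) : x \in `](-1), 1[ -> {for x, continuous f}.
  move=> x1; apply: continuousM; first exact: continuous_horner.
  have [/derivable1_diffP/differentiable_continuous + _] :=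
    is_derive_one_subr_sqr_powR al x1.
  exact.
pose G x := parameterized_integral mu (-1) x f.
have cG : {within `[(-1), 1], continuous G}.
  by apply: parameterized_integral_continuous => //; lra.
have FG y z : -1 < y -> y < z -> z < 1 -> G z - G y = F z - F y.
  move=> y1 yz z1.
  have sub (x : R) : x \in `[y, z] -> x \in `](-1), 1[.
    by rewrite !in_itv/= => /andP[xy xz]; apply/andP; split; lra.
  have intyz : mu.-integrable `[(-1), z] (EFin \o f).
    by apply: integrableS intf => //; apply: subset_itvl; rewrite bnd_simp; lra.
  have cyz : {within `[y, z], continuous f}.
    apply: continuous_in_subspaceT => x; rewrite inE/= => xyz.
    by apply: cf; apply: sub.
  rewrite /G /parameterized_integral Rintegral_itvB ?bnd_simp ?(ltW y1) ?(ltW yz)//.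
  rewrite Rintegral_itv_obnd_cbnd; last first.
    by apply: integrableS intyz => //; apply: subset_itvr; rewrite bnd_simp ltW.
  rewrite /Rintegral (@continuous_FTC2 _ f F)//.
    have yy : y \in `[y, z] by rewrite in_itv/= lexx ltW.
    have zz : z \in `[y, z] by rewrite in_itv/= lexx ltW.
    split=> [x xyz||].
    - by have [] := dF x (sub x (subset_itv_oo_cc xyz)).
    - by apply: cvg_at_right_filter; apply: cF; exact: sub.
    - by apply: cvg_at_left_filter; apply: cF; exact: sub.
  by move=> x xyz; rewrite derive1E; have [_ ->] := dF x (sub x (subset_itv_oo_cc xyz)).
have N11 : (-1 : R) < 1 by lra.
have [_ GN1 G1] := (continuous_within_itvP G N11).1 cG.
have F0 := @cvg_pearson_right (al + 1) p ltac:(lra).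
have F1 := @cvg_pearson_left (al + 1) p ltac:(lra).
have GFcst y : -1 < y -> y < 1 -> G y - F y = G 0 - F 0.
  move=> y1 y2; have [y0|y0|->//] := ltgtP y 0.
    by have := FG y 0 y1 y0 ltr01; lra.
  by have := FG 0 y ltac:(lra) y0 y2; lra.
have G00 : G (-1) = 0 by rewrite /G /parameterized_integral set_itv1 Rintegral_set1.
have GF0 : G 0 - F 0 = 0.
  have c1 : (G y - F y) @[y --> (-1)^'+] --> G 0 - F 0.
    apply: cvg_near_cst; near=> y; apply: GFcst; near: y.
      exact: nbhs_right_gt.
    exact: nbhs_right_lt.
  have c2 : (G y - F y) @[y --> (-1)^'+] --> G (-1) - 0 by apply: cvgB.
  by rewrite (cvg_unique _ c1 c2)// G00 subr0.
have c1 : (G y - F y) @[y --> 1^'-] --> G 0 - F 0.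
  apply: cvg_near_cst; near=> y; apply: GFcst; near: y.
    exact: nbhs_left_gt.
  exact: nbhs_left_lt.
have c2 : (G y - F y) @[y --> 1^'-] --> G 1 - 0 by apply: cvgB.
by have := cvg_unique _ c2 c1; rewrite GF0 subr0; apply.
Unshelve. all: by end_near. Qed.

Lemma integrable_itv_oo_cc (a b : R) (f : R -> R) :
  mu.-integrable `]a, b[ (EFin \o f) -> mu.-integrable `[a, b] (EFin \o f).
Proof.
move=> /integrableP[mf foo].
have mf' : measurable_fun `]a, b[ f by apply/measurable_EFinP.
apply/integrableP; split.
  apply/measurable_EFinP.
  exact: measurable_fun_itv_cc mf'.
rewrite (_ : (fun x => `|_ x|)%E = EFin \o (fun x => `|f x|)); last by apply/funext.
rewrite (integral_itv_bndoo (f := fun x => (`|f x|)%:E))//.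
by apply/measurable_EFinP/measurableT_comp.
Qed.

Lemma horner_bounded_Icc (p : {poly R}) (x : R) : x \in `[(-1), 1] ->
  `|p.[x]| <= \sum_(i < size p) `|p`_i|.
Proof.
rewrite in_itv/= => x1; have {}x1 : `|x| <= 1 by rewrite ler_norml.
rewrite horner_coef (le_trans (ler_norm_sum _ _ _))//.
by apply: ler_sum => i _; rewrite normrM normrX ler_piMr ?exprn_ile1.
Qed.

Section JacobiMeasure.
Context (al : R) (P : nat -> {poly R}).
Hypothesis al_gtN1 : -1 < al.
Hypothesis orthP : is_orthonormal_jacobi al P.

Let w0 (x : R) := (1 - x ^+ 2) `^ al.

Lemma real_beta_ge0 (a b : R) : 0 <= real_beta a b.
Proof. by apply: Rintegral_ge0 => x _; rewrite mulr_ge0 ?powR_ge0. Qed.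

Lemma jacobi_const_gt0 : 0 < jacobi_const al.
Proof.
rewrite lt_neqAle eq_sym invr_ge0 real_beta_ge0 andbT; apply/eqP => c0.
have [_ _ /(_ 0%N 0%N)] := orthP; rewrite /jacobi_inner.
under eq_integral do rewrite /jacobi_density c0 mul0r mulr0.
by rewrite integral0 => /eqP; rewrite eqe eq_sym oner_eq0.
Qed.

Lemma measurable_one_subr_sqr_powR (D : set R) : measurable_fun D w0.
Proof.
apply: measurable_funTS; apply: (measurableT_comp (measurable_powR al)).
apply: measurable_funB; first exact: measurable_cst.
exact: measurable_funX.
Qed.

Lemma integrable_horner_weight (p : {poly R}) :
  mu.-integrable `](-1), 1[ (EFin \o (fun x => p.[x] * w0 x)).
Proof.
have c0 := jacobi_const_gt0.
have [sizeP leadP ortho] := orthP.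
have P0E : P 0%N = (lead_coef (P 0%N))%:P.
  by rewrite [LHS]size1_polyC ?sizeP// lead_coefE sizeP.
have mw : measurable_fun (`](-1), 1[ : set R) w0 by apply: measurable_one_subr_sqr_powR.
have w_int : mu.-integrable `](-1), 1[ (EFin \o w0).
  pose k := lead_coef (P 0%N) * lead_coef (P 0%N) * jacobi_const al.
  have k0 : 0 < k by rewrite /k !mulr_gt0.
  have kint : mu.-integrable `](-1), 1[ (EFin \o (fun x => k * w0 x)).
    apply/integrableP; split.
      by apply/measurable_EFinP/measurable_funM => //; exact: measurable_cst.
    have := ortho 0%N 0%N; rewrite eqxx /jacobi_inner => h.
    change (\int[mu]_(x in `](-1)%R, 1%R[) (`|k * w0 x|%R)%:E < +oo)%E.
    suff -> : (\int[mu]_(x in `](-1)%R, 1%R[) (`|k * w0 x|%R)%:E = 1%:E)%E.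
      by rewrite ltry.
    transitivity ((true%:R : R)%:E); last by [].
    rewrite -h; apply: eq_integral => x _ /=.
    rewrite ger0_norm; last by rewrite mulr_ge0 ?(ltW k0)//; exact: powR_ge0.
    by rewrite P0E !hornerC /k /jacobi_density mulrA.
  have : mu.-integrable `](-1), 1[ (fun x => (k^-1)%:E * (k * w0 x)%:E)%E.
    exact: integrableZl.
  apply: eq_integrable => // x _ /=.
  by rewrite -EFinM mulrA mulVf ?mul1r// gt_eqF.
pose B := \sum_(i < size p) `|p`_i|.
apply: (@le_integrable _ _ _ mu _ _ _ (EFin \o (fun x => B * w0 x))) => //.
- apply/measurable_EFinP/measurable_funM => //; apply: measurable_funTS.
  by apply: continuous_measurable_fun => x; exact: continuous_horner.
- move=> x /= x1; rewrite lee_fin !normrM ler_wpM2r//.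
  rewrite [leRHS]ger0_norm ?sumr_ge0//; apply: horner_bounded_Icc.
  exact: subset_itv_oo_cc.
- have : mu.-integrable `](-1), 1[ (fun x => B%:E * (w0 x)%:E)%E.
    exact: integrableZl.
  by apply: eq_integrable.
Qed.

Lemma jacobi_functional : exists L : {scalar {poly R}},
  [/\ forall p, L p = jacobi_const al * \int[mu]_(x in `](-1), 1[) (p.[x] * w0 x),
      forall m n, L (P m * P n) = (m == n)%:R
    & forall p, L ((1 - 'X^2) * p^`() - (2 * (al + 1)) *: ('X * p)) = 0].
Proof.
pose L p := jacobi_const al * \int[mu]_(x in `](-1), 1[) (p.[x] * w0 x).
have L_lin : scalar L.
  move=> c p q; rewrite /L.
  have -> : \int[mu]_(x in `](-1), 1[) ((c *: p + q).[x] * w0 x) =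
      \int[mu]_(x in `](-1), 1[) (c * (p.[x] * w0 x) + q.[x] * w0 x).
    by apply: eq_Rintegral => x _; rewrite hornerD hornerZ mulrDl mulrA.
  rewrite RintegralD ?RintegralZl//; first by ring.
  - exact: integrable_horner_weight.
  - have : mu.-integrable `](-1), 1[ (fun x => c%:E * (p.[x] * w0 x)%:E)%E.
      by apply: integrableZl => //; exact: integrable_horner_weight.
    by apply: eq_integrable.
  - exact: integrable_horner_weight.
pose LL : {scalar {poly R}} := HB.pack L (GRing.isLinear.Build _ _ _ _ L L_lin).
exists LL; split=> [//|m n|p].
- have [_ _ /(_ m n)] := orthP; rewrite /jacobi_inner => h.
  have -> : LL (P m * P n) = fine (\int[mu]_(x in `](-1)%R, 1%R[)
      ((P m).[x] * (P n).[x] * jacobi_density al x)%:E)%E; last by rewrite h.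
  rewrite -[LHS]/(L _) /L -RintegralZl//; last exact: integrable_horner_weight.
  by apply: eq_Rintegral => x _; rewrite hornerM /jacobi_density mulrCA.
rewrite -[LHS]/(L _) /L.
set q := _ - _; have hq := integrable_horner_weight q.
have -> : \int[mu]_(x in `](-1), 1[) (q.[x] * w0 x) =
    \int[mu]_(x in `[(-1), 1]) (q.[x] * w0 x).
  by have /integrableP[mq _] := hq; rewrite /Rintegral (integral_itv_bndoo true false mq).
by rewrite (Rintegral_pearson al_gtN1 (integrable_itv_oo_cc hq)) mulr0.
Qed.

Lemma within_continuous_weight : 0 < al -> {within `[(-1), 1], continuous w0}.
Proof.
move=> al0; apply/continuous_within_itvP; first by lra.
split.
- move=> x x1; have [/derivable1_diffP/differentiable_continuous + _] :=
    is_derive_one_subr_sqr_powR al x1.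
  exact.
- have := @cvg_pearson_right al 1 al0.
  rewrite [w0 (-1)]/w0 sqrrN expr1n subrr powR0 ?gt_eqF//.
  by under eq_fun do rewrite hornerC mul1r.
- have := @cvg_pearson_left al 1 al0.
  rewrite [w0 1]/w0 expr1n subrr powR0 ?gt_eqF//.
  by under eq_fun do rewrite hornerC mul1r.
Qed.

(* The substitution t = 1 - x^2, stopped at x = e, where (1 - t)^(-1/2) is
   still continuous. *)
Lemma integral_weight_half_le_beta (e : R) : 0 < al -> 0 < e < 1 ->
  2 * \int[mu]_(x in `[e, 1]) w0 x <= real_beta (al + 1) 2^-1.
Proof.
move=> al0 /andP[e0 e1].
pose G (t : R) := t `^ (al + 1 - 1) * (1 - t) `^ (2^-1 - 1).
pose F (x : R) := 1 - x ^+ 2.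
have dF (x : R) : is_derive x 1 F (- (2 * x)).
  by apply: is_derive_eq; rewrite /GRing.scale/=; ring.
have F'E : derive1 F = fun x => - (2 * x).
  by apply/funext => x; rewrite derive1E; have [_ ->] := dF x.
have cF : continuous F.
  by move=> x; have [/derivable1_diffP/differentiable_continuous] := dF x.
have cF' : continuous (derive1 F).
  by rewrite F'E => x; apply: cvgN; apply: cvgM; [exact: cvg_cst|exact: cvg_id].
have F1 : F 1 = 0 by rewrite /F expr1n subrr.
have Fe : 0 < F e by rewrite /F; nra.
have Fe1 : F e < 1 by rewrite /F; nra.
have cG : {within `[F 1, F e], continuous G}.
  rewrite F1; apply/continuous_within_itvP => //.
  have c2 (t : R) : t < 1 -> {for t, continuous (fun t : R => (1 - t) `^ (2^-1 - 1))}.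
    move=> t1; apply: (@continuous_comp _ _ _ (fun t : R => 1 - t) (fun z => z `^ (2^-1 - 1))).
      by apply: continuousB => //; exact: cvg_cst.
    apply/differentiable_continuous/derivable1_diffP/derivable_powR.
    by rewrite in_itv/= andbT subr_gt0.
  have c1 (t : R) : 0 < t -> {for t, continuous (fun t : R => t `^ (al + 1 - 1))}.
    move=> t0; apply/differentiable_continuous/derivable1_diffP/derivable_powR.
    by rewrite in_itv/= andbT.
  split.
  - move=> t; rewrite in_itv/= => /andP[t0 t1].
    by apply: cvgM; [exact: c1|apply: c2; exact: lt_trans Fe1].
  - have pc : t `^ (al + 1 - 1) @[t --> 0^'+] --> (0 : R).
      by apply: powR_cvg0; rewrite addrK.
    have -> : G 0 = 0 * (1 - 0) `^ (2^-1 - 1).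
      by rewrite /G powR0// addrK gt_eqF.
    apply: cvgM; first exact: pc.
    by apply: cvg_at_right_filter; apply: c2.
  - by apply: cvg_at_left_filter; apply: cvgM; [exact: c1|exact: c2].
have decF : {in `[e, 1] &, {homo F : x y /~ x < y}}.
  by move=> x y; rewrite !in_itv/= /F => /andP[x1 x2] /andP[y1 y2] xy; nra.
have subst := @integration_by_substitution_decreasing R F G e 1 (ltW e1) decF
  (fun x _ => cF' x) _ _ _ cG.
have w_int : mu.-integrable `[e, 1] (EFin \o w0).
  have := integrable_itv_oo_cc (integrable_horner_weight 1).
  move=> /(@integrableS _ _ _ mu _ `[e, 1]) h.
  have : mu.-integrable `[e, 1] (EFin \o (fun x => (1 : {poly R}).[x] * w0 x)).
    by apply: h => //; apply: subset_itvr; rewrite bnd_simp; lra.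
  by apply: eq_integrable => // x _ /=; rewrite hornerC mul1r.
have G0 t : 0 <= G t by rewrite mulr_ge0 ?powR_ge0.
have mG : measurable_fun (`]0, 1[ : set R) G.
  apply: measurable_funM; apply: measurable_funTS; first exact: measurable_powR.
  apply: (measurableT_comp (measurable_powR _)).
  by apply: measurable_funB => //; exact: measurable_cst.
have beta_fin : (\int[mu]_(t in `]0%R, 1%R[) (G t)%:E \is a fin_num)%E.
  rewrite ge0_fin_numE; last by apply: integral_ge0 => t _; rewrite lee_fin.
  rewrite ltey; apply/eqP => h; have := jacobi_const_gt0.
  by rewrite /jacobi_const /real_beta /Rintegral h /= invr0 ltxx.
have -> : 2 * \int[mu]_(x in `[e, 1]) w0 x = \int[mu]_(x in `[e, 1]) (2 * w0 x).
  by rewrite RintegralZl.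
apply: fine_le; [|exact: beta_fin|].
  have w2 : mu.-integrable `[e, 1] (fun x => 2%:E * (w0 x)%:E)%E.
    exact: integrableZl.
  by apply: integrable_fin_num => //; apply: eq_integrable w2.
have -> : (\int[mu]_(x in `[e, 1%R]) (2 * w0 x)%:E)%E =
    (\int[mu]_(x in `[F 1%R, F e]) (G x)%:E)%E.
  rewrite subst.
  - apply: eq_integral => x; rewrite inE/= in_itv/= => /andP[ex x1].
    have x0 : 0 < x by exact: lt_le_trans ex.
    congr (_%:E); rewrite F'E -[RHS]/(G (F x) * - - (2 * x)) opprK /G /F.
    rewrite addrK (_ : 1 - (1 - x ^+ 2) = x ^+ 2); last by ring.
    rewrite -powR_mulrn ?(ltW x0)// -powRrM (_ : 2%:R * (2^-1 - 1) = -1); last by field.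
    by rewrite powR_inv1 ?(ltW x0)// /w0 powR_mulrn ?(ltW x0)//; field; rewrite gt_eqF.
  - by apply: cvgP; apply: cvg_at_right_filter; exact: cF'.
  - by apply: cvgP; apply: cvg_at_left_filter; exact: cF'.
  - split=> [x _||].
    + by have [dFx _] := dF x; exact: dFx.
    + by apply: cvg_at_right_filter; exact: cF.
    + by apply: cvg_at_left_filter; exact: cF.
have sub01 : `]0, F e[ `<=` `]0, 1[ by apply: subset_itvl; rewrite bnd_simp ltW.
have mGe : measurable_fun (`]0, F e[ : set R) (fun x => (G x)%:E).
  by apply/measurable_EFinP; apply: measurable_funS mG.
rewrite F1 (integral_itv_bndoo _ _ mGe).
apply: ge0_subset_integral => //.
- exact/measurable_EFinP.
- by move=> t _; rewrite lee_fin.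
Qed.

Lemma integral_weight_le_beta : 0 < al ->
  \int[mu]_(x in `](-1), 1[) w0 x <= real_beta (al + 1) 2^-1.
Proof.
move=> al0.
have w_oo : mu.-integrable `](-1), 1[ (EFin \o w0).
  apply: eq_integrable (integrable_horner_weight 1) => // x _ /=.
  by rewrite hornerC mul1r.
have w_cc := integrable_itv_oo_cc w_oo.
have w_sub (a b : R) : -1 <= a -> b <= 1 -> mu.-integrable `[a, b] (EFin \o w0).
  move=> a1 b1; apply: integrableS w_cc => // x /=.
  by rewrite !in_itv/= => /andP[x1 x2]; apply/andP; split; lra.
have split_at (a c b : R) : -1 <= a -> a <= c -> c <= b -> b <= 1 ->
    \int[mu]_(x in `[a, b]) w0 x =
    \int[mu]_(x in `[a, c]) w0 x + \int[mu]_(x in `[c, b]) w0 x.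
  move=> a1 ac cb b1.
  rewrite -[X in _ + X]Rintegral_itv_obnd_cbnd; last first.
    by apply: integrableS (w_sub c b _ b1) => //; [apply: subset_itvr; rewrite bnd_simp|lra].
  have := @Rintegral_itvB R w0 (BLeft a) (BRight b) c (w_sub a b a1 b1).
  by rewrite !bnd_simp => /(_ ac cb) <-; rewrite addrC subrK.
have sym : \int[mu]_(x in `[(-1), 0]) w0 x = \int[mu]_(x in `[0, 1]) w0 x.
  have := @integration_by_substitution_oppr R w0 0 1 ler01; rewrite oppr0 => wN.
  rewrite /Rintegral wN; first by congr fine; apply: eq_integral => x _ /=; rewrite /w0 sqrrN.
  apply: continuous_subspaceW (within_continuous_weight al0).
  by apply: subset_itvl; rewrite bnd_simp.
have near0 (e : R) : 0 < e < 1 -> \int[mu]_(x in `[0, e]) w0 x <= e.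
  move=> /andP[e0 e1].
  have cst1 : mu.-integrable `[0, e] (EFin \o (fun=> 1 : R)).
    apply: continuous_compact_integrable; first exact: segment_compact.
    by apply: continuous_subspaceT => x; exact: cst_continuous.
  have e_int : \int[mu]_(x in `[0, e]) (1 : R) = e.
    rewrite Rintegral_cst// mul1r [X in fine X](_ : _ = e%:E)//.
    apply: (etrans (lebesgue_measure_itv `[0, e])).
    by rewrite /= lte_fin e0 -EFinB subr0.
  rewrite -[leRHS]e_int; apply: le_Rintegral => //; first by apply: w_sub; lra.
  move=> x /=; rewrite in_itv/= => /andP[x0 xe].
  have := @ge0_ler_powR R al (ltW al0) (1 - x ^+ 2) 1; rewrite powR1 !nnegrE.
  by apply; nra.
have -> : \int[mu]_(x in `](-1), 1[) w0 x = \int[mu]_(x in `[(-1), 1]) w0 x.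
  by have /integrableP[mw _] := w_oo; rewrite /Rintegral (integral_itv_bndoo true false mw).
rewrite (split_at (-1) 0 1) ?lerN10// sym.
apply/ler_addgt0Pr => e e0.
have [d /andP[d0 d1] de] : exists2 d, 0 < d < 1 & d <= e / 2.
  exists (Num.min (e / 2) (1 / 2)); last by rewrite ge_min lexx.
  rewrite lt_min !divr_gt0//= gt_min; apply/orP; right; lra.
have d01 : 0 < d < 1 by rewrite d0.
rewrite (split_at 0 d 1) ?lerN10 ?(ltW d0) ?(ltW d1)//.
have := near0 d d01; have := integral_weight_half_le_beta al0 d01.
move: (real_beta _ _) (Rintegral _ _ _) (Rintegral _ _ _) => x y z.
by clear -de; lra.
Qed.

Lemma sqr_orthonormal0_ge1 (x : R) : 0 < al -> 1 <= (P 0%N).[x] ^+ 2.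
Proof.
move=> al0; have [L [LE orthL _]] := jacobi_functional.
have [sizeP _ _] := orthP.
have P0E : P 0%N = (lead_coef (P 0%N))%:P.
  by rewrite [LHS]size1_polyC ?sizeP// lead_coefE sizeP.
have L1 : L 1 <= 1.
  rewrite LE; have := integral_weight_le_beta al0; have := jacobi_const_gt0.
  rewrite /jacobi_const invr_gt0 => b0 hb.
  rewrite ler_pdivrMl// mulr1 (le_trans _ hb)//.
  by under eq_Rintegral do rewrite hornerC mul1r.
have := orthL 0%N 0%N; rewrite P0E -polyCM -alg_polyC linearZ/= hornerC => h.
by have := sqr_ge0 (lead_coef (P 0%N)); rewrite expr2; nra.
Qed.

End JacobiMeasure.

End JacobiWeight.

Theorem corollary3p4 (R : realType) (alpha : R) (halpha : -1 < alpha)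
    (P : nat -> {poly R}) (hP : is_orthonormal_jacobi alpha P) :
  (1 / 2 <= alpha ->
     2 / (2 * alpha + 3) <= inf (consecutive_square_sums P)) /\
  (alpha < 1 / 2 -> inf (consecutive_square_sums P) = 0).
Proof.
have [L [_ orthL pearson]] := jacobi_functional halpha hP.
have [sizeP leadP _] := hP.
have [a [a0 a_gt0 XP DP rec_sq_a]] :=
  jacobi_recurrence sizeP leadP orthL halpha pearson.
have recP n x : x * (P n).[x] = a n.+1 * (P n.+1).[x] + a n * (P n.-1).[x].
  by have := congr1 (horner^~ x) (XP n); rewrite hornerD !hornerZ hornerM hornerX.
have P_at1 n : n%:R * (a n.+1 * (P n.+1).[1]) =
    (n%:R + 2 * alpha + 1) * (a n * (P n.-1).[1]).
  have := congr1 (horner^~ 1) (DP n); rewrite hornerD !hornerZ hornerM.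
  by rewrite hornerD hornerN hornerXn hornerC expr1n subrr mul0r; lra.
have S0 : consecutive_square_sums P !=set0.
  by exists ((P 1%N).[0] ^+ 2 + (P 0%N).[0] ^+ 2), 0, 1%N.
split=> halpha2.
  apply: lb_le_inf => // _ [x [[|n] [n1 ->]]] //.
  have ha : 2^-1 <= alpha by lra.
  apply: (sum_sqr_lower_bound a0 a_gt0 recP rec_sq_a) => // y.
  by apply: (sqr_orthonormal0_ge1 halpha hP); lra.
have small e : 0 < e -> exists x n, (P n.+1).[x] ^+ 2 + (P n).[x] ^+ 2 < e.
  move=> e0; have [ha|ha] := leP (- 2^-1) alpha.
    by apply: (sum_sqr_small_near1 halpha a0 a_gt0 recP rec_sq_a P_at1); lra.
  by exists 1; apply: (sum_sqr_small_at1 halpha a0 recP rec_sq_a P_at1).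
have lb0 : lbound (consecutive_square_sums P) 0.
  by move=> _ [x [n [_ ->]]]; rewrite addr_ge0 ?sqr_ge0.
apply/eqP; rewrite eq_le lb_le_inf// andbT leNgt; apply/negP => /small[x [n]].
apply/negP; rewrite -leNgt; apply: ge_inf; first by exists 0.
by exists x, n.+1.
Qed.
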